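(* For every positive integer $d$ and every real $0<\varepsilon<1$, there is a constant $\gamma=\gamma_d(\varepsilon) > 0$ such that the following holds. Let $n$ be a positive integer, and let $A \subseteq \mathbb{R}^d$ be an $n$-element set. If each proper subspace of $\mathbb{R}^d$ contains at most $(1-\varepsilon)n$ elements of $A$, then $|\mathrm{FS}(A)| \geq \gamma n^{d+1}$.
   Context: For a finite subset $A$ of an abelian group, $\mathrm{FS}(A):=\{\sum_{x\in B}x : B\subseteq A\}$ is the set of subset sums of $A$ (the empty subset gives $0$). ''Subspace'' means linear subspace. *)

(* Defs.v *)
From mathcomp Require Import all_boot all_order all_algebra.
From mathcomp Require Import finmap.
From mathcomp Require Import reals.

Set Implicit Arguments.
Unset Strict Implicit.
Unset Printing Implicit Defensive.

Import GRing.Theory.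

Local Open Scope fset_scope.
Local Open Scope ring_scope.

Definition FS (G : zmodType) (A : {fset G}) : {fset G} :=
  [fset \sum_(x <- enum_fset B) x | B : {fset G} in fpowerset A].

(* Main.v *)
Require Import Defs.
From HB Require Import structures.
From mathcomp Require Import all_boot all_order all_algebra.
From mathcomp Require Import finmap.
From mathcomp Require Import reals.
From mathcomp Require Import zify ring lra.

Set Implicit Arguments.
Unset Strict Implicit.
Unset Printing Implicit Defensive.

Import Order.TTheory GRing.Theory Num.Theory.

Local Open Scope fset_scope.
Local Open Scope ring_scope.

(** Subset sums are built up greedily: elements [b] of [A] are added to a
subset [A'] one at a time, and each new [b] enlarges [S = FS A'] by the number
of [s] in [S] with [s + b] outside [S], written [escape S b] below.  The point
is to find, among the unused elements [B] of [A], one with a large escape.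

The function [escape S] is subadditive.  Hence, if all its values on [B] were
at most [t], its values on a [k]-fold sumset of [B] would be at most [k * t].
But on a set [X] with at least [2 * #|S|] elements some value is at least
[#|S| / 2], because the pairs [(x, s)] with [s + x] in [S] number at most
[#|S| ^ 2] ([exists_large_escape]).  So iterated sumsets of [B] have to be
large, and they are: if [B] spans the space, about [d * k] summands from [B]
and [0] yield at least [(k / 2) ^ d * #|B|] points ([card_nsum_ge]).  Together
([exists_escape_spanning]) some [b] in [B] satisfies
[escape S b >= #|S| / (2 * (d * k + 1))] as soon as
[k ^ d * #|B| >= 2 ^ (d + 1) * #|S|].

Now [B] spans, and contains at least half of [A], as long as a small enough
proportion of [A] has been used: otherwise a proper subspace would contain too
much of [A].  With [n = #|A|], take [k = i + 1] while [#|S|] is between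
constant multiples of [i ^ d * n] and [(i + 1) ^ d * n].  Each step then
multiplies [#|S|] by at least [1 + c / i], so boundedly many steps (the bound
depending on [d] only) lead from one threshold to the next ([FS_grow]).  A
fixed proportion of [n] steps is available, so [i] reaches a fixed proportion
of [n], which gives the order of magnitude [n ^ d * n].  The process is
started at [i = 1] from an arbitrary subset of proportional size, each element
of which is itself a subset sum. *)

(** * Counting by fibres *)

Lemma sum_mem_count (T : choiceType) (E : {fset T}) (P : pred T) :
  (\sum_(x <- E) P x = #|` [fset x in E | P x]|)%N.
Proof.
rewrite card_fset_sum1 big_fset /= [RHS]big_mkcond /=.
by apply: eq_bigr => x _; case: (P x).
Qed.

Lemma sum_card_fibers (T U : choiceType) (f : T -> U) (E : {fset T})
    (Y : {fset U}) :
  (\sum_(y <- Y) #|` [fset x in E | f x == y]|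
     = #|` [fset x in E | f x \in Y]|)%N.
Proof.
rewrite -sum_mem_count.
under eq_bigr => y _ do rewrite -sum_mem_count.
rewrite exchange_big /=; apply: eq_bigr => x _.
rewrite sum_mem_count.
have [fxY|fxY] := boolP (f x \in Y).
  suff -> : [fset y in Y | f x == y] = [fset f x] by rewrite cardfs1.
  apply/fsetP=> y; rewrite !inE /= eq_sym.
  by case: eqP => [->|]; rewrite ?fxY ?andbF.
apply/eqP; rewrite cardfs_eq0; apply/eqP/fsetP=> y; rewrite !inE /=.
by apply/negP=> /andP[yY /eqP fxy]; rewrite fxy yY in fxY.
Qed.

Lemma sum_fset_const (T : choiceType) (Y : {fset T}) (M : nat) :
  (\sum_(y <- Y) M = #|` Y| * M)%N.
Proof. by rewrite big_const_seq count_predT iter_addn_0 mulnC. Qed.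

(** Used as a lower bound: it replaces an injection from a product into [E], and
so avoids choosing a preimage for each point of [Y]. *)
Lemma leq_card_fibers (T U : choiceType) (f : T -> U) (E : {fset T})
    (Y : {fset U}) (M : nat) :
  (forall y, y \in Y -> M <= #|` [fset x in E | f x == y]|)%N ->
  (#|` Y| * M <= #|` E|)%N.
Proof.
move=> HM; apply: (@leq_trans #|` [fset x in E | f x \in Y]|); last first.
  by apply: fsubset_leq_card; apply/fsubsetP=> x; rewrite !inE => /andP[].
rewrite -sum_card_fibers -sum_fset_const big_seq [leqRHS]big_seq.
exact: leq_sum.
Qed.

Lemma fset_argmax (T : choiceType) (Y : {fset T}) disp (K : orderType disp)
    (F : T -> K) :
  Y != fset0 -> exists2 y, y \in Y & forall z, z \in Y -> (F z <= F y)%O.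
Proof.
case/fset0Pn=> y0 y0Y.
case: (@arg_maxP _ _ Y [` y0Y] predT (fun z => F (val z)) isT) => y _ Hy.
by exists (val y) => [|z zY]; [exact: valP | exact: (Hy [` zY])].
Qed.

Lemma exists_large_fiber (T U : choiceType) (f : T -> U) (E : {fset T}) :
  E != fset0 ->
  exists2 y, (#|` E| <= #|` f @` E| * #|` [fset x in E | f x == y]|)%N
   & forall z, (#|` [fset x in E | f x == z]| <= #|` [fset x in E | f x == y]|)%N.
Proof.
case/fset0Pn=> x0 x0E.
have fE0 : f @` E != fset0 by apply/fset0Pn; exists (f x0); apply: in_imfset.
pose F y := #|` [fset x in E | f x == y]|.
have [y yY ymax] := fset_argmax F fE0.
exists y => [|z]; last first.
  have [zY|zY] := boolP (z \in f @` E); first exact: ymax.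
  rewrite [leqLHS](_ : _ = 0%N) //; apply/eqP; rewrite cardfs_eq0.
  apply/eqP/fsetP=> x; rewrite !inE /=.
  by apply: contraNF zY => /andP[xE /eqP <-]; apply: in_imfset.
have -> : #|` E| = #|` [fset x in E | f x \in f @` E]|.
  congr #|` _|; apply/fsetP=> x; rewrite !inE /=.
  by have [xE|//] := boolP (x \in E); rewrite in_imfset.
rewrite -sum_card_fibers -sum_fset_const big_seq [leqRHS]big_seq.
by apply: leq_sum => z /ymax.
Qed.

(** * Iterated sumsets *)

Lemma card_translate (G : zmodType) (x : G) (Y : {fset G}) :
  #|` [fset x + y | y in Y]| = #|` Y|.
Proof. by rewrite card_imfset //; apply: addrI. Qed.

Definition sumset (G : zmodType) (X Y : {fset G}) : {fset G} :=
  [fset x + y | x in X, y in Y].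

Lemma sumsetP (G : zmodType) (X Y : {fset G}) z :
  reflect (exists x y, [/\ x \in X, y \in Y & z = x + y]) (z \in sumset X Y).
Proof.
apply: (iffP (imfset2P _ _ _ _ _)) => [[x xX [y yY ->]]|[x [y [xX yY ->]]]].
  by exists x, y.
by exists x => //; exists y.
Qed.

Lemma mem_sumset (G : zmodType) (X Y : {fset G}) x y :
  x \in X -> y \in Y -> x + y \in sumset X Y.
Proof. by move=> xX yY; apply/sumsetP; exists x, y. Qed.

Definition nsum (G : zmodType) (B : {fset G}) (k : nat) : {fset G} :=
  iter k (sumset B) [fset 0].
Arguments nsum {G} B k : simpl never.

Lemma nsum0 (G : zmodType) (B : {fset G}) : nsum B 0%N = [fset 0].
Proof. by []. Qed.

Lemma nsumSr (G : zmodType) (B : {fset G}) k :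
  nsum B k.+1 = sumset B (nsum B k).
Proof. by []. Qed.

Lemma nsum1 (G : zmodType) (B : {fset G}) : nsum B 1%N = B.
Proof.
apply/fsetP=> x; apply/sumsetP/idP => [[y [z []]]|xB].
  by rewrite inE => yB /eqP-> ->; rewrite addr0.
by exists x, 0; rewrite addr0 inE.
Qed.

Lemma nsumD (G : zmodType) (B : {fset G}) k l x y :
  x \in nsum B k -> y \in nsum B l -> x + y \in nsum B (k + l)%N.
Proof.
elim: k x => [|k IH] x; first by rewrite inE => /eqP->; rewrite add0r.
move=> /sumsetP[u [v [uB vB ->]]] yB.
by rewrite -addrA addSn; apply: mem_sumset => //; apply: IH.
Qed.

Lemma nsumS (G : zmodType) (B C : {fset G}) k :
  B `<=` C -> nsum B k `<=` nsum C k.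
Proof.
move=> /fsubsetP BC; elim: k => [|k /fsubsetP IH]; first exact: fsubset_refl.
apply/fsubsetP=> _ /sumsetP[x [y [/BC xC /IH yC ->]]].
exact: mem_sumset.
Qed.

Lemma nsum_imfset (G H : zmodType) (f : {additive G -> H}) (B : {fset G}) k :
  nsum (f @` B) k = f @` nsum B k.
Proof.
elim: k => [|k IH]; first by rewrite !nsum0 imfset_fset1 raddf0.
rewrite !nsumSr IH; apply/fsetP=> z.
apply/sumsetP/imfsetP => /= [[_ [_ [/imfsetP[x /= xB ->] /imfsetP[y /= yB ->] ->]]]|].
  by exists (x + y); rewrite ?raddfD //; apply: mem_sumset.
move=> [_ /sumsetP[x [y [xB yB ->]]] ->]; exists (f x), (f y).
by rewrite raddfD !in_imfset.
Qed.

(** The translates of [X] by [min Y] and of [Y] by [max X] lie in the sumset,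
one below the other, and share only the point [max X + min Y]. *)
Lemma card_sumset_ge (R : realDomainType) (X Y : {fset R}) :
  X != fset0 -> Y != fset0 -> (#|` X| + #|` Y| <= (#|` sumset X Y|).+1)%N.
Proof.
move=> X0 Y0.
have [x xX xmax] := fset_argmax id X0.
have [y yY ymin] := fset_argmax -%R Y0.
pose U := [fset y + u | u in X]; pose V := [fset x + v | v in Y].
have cU : #|` U| = #|` X| by apply: card_translate.
have cV : #|` V| = #|` Y| by apply: card_translate.
have UV : (#|` U `&` V| <= 1)%N.
  rewrite -(cardfs1 (x + y)); apply: fsubset_leq_card; apply/fsubsetP=> z.
  rewrite !inE /= => /andP[/imfsetP[u /= uX ->] /imfsetP[v /= vY uv]].
  have ux : u <= x := xmax _ uX; have := ymin _ vY; rewrite lerN2 => yv.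
  by rewrite addrC eq_le lerD2r addrC uv lerD2l; apply/andP.
have := cardfsUI U V; rewrite cU cV => <-.
rewrite -[in leqRHS]addn1 leq_add //.
apply: fsubset_leq_card; apply/fsubsetP=> z; rewrite inE.
by case/orP=> /imfsetP[u /= uX ->]; rewrite 1?(addrC y); apply: mem_sumset.
Qed.

Lemma card_nsum_real (R : realDomainType) (F : {fset R}) k :
  F != fset0 -> (k * (#|` F|).-1 < #|` nsum F k|)%N.
Proof.
move=> F0; elim: k => [|k IH]; first by rewrite nsum0 cardfs1.
have k0 : nsum F k != fset0 by rewrite -cardfs_gt0; apply: leq_ltn_trans IH.
have := card_sumset_ge F0 k0; rewrite -nsumSr.
move: F0; rewrite -cardfs_gt0 => F0.
move: IH; set a := #|` nsum F k|; set b := #|` nsum F k.+1|.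
by rewrite mulSn; lia.
Qed.

(** * Sumsets of spanning sets grow like the power of the dimension *)

(** Splitting off the line through [b] without quotient spaces: when
[b 0 j != 0], [eliminate] is the projection along [b] that clears coordinate
[j], and [pivot_coord] is the complementary coordinate along [b]. *)
Section Elimination.
Variables (R : realFieldType) (d : nat) (b : 'rV[R]_d) (j : 'I_d).

Definition pivot_coord (x : 'rV[R]_d) : R := x 0 j / b 0 j.
Definition eliminate (x : 'rV[R]_d) : 'rV[R]_d := x - pivot_coord x *: b.

Fact pivot_coord_is_zmod_morphism : zmod_morphism pivot_coord.
Proof. by move=> x y; rewrite /pivot_coord !mxE mulrBl. Qed.
HB.instance Definition _ :=
  GRing.isZmodMorphism.Build _ _ pivot_coord pivot_coord_is_zmod_morphism.

Fact eliminate_is_zmod_morphism : zmod_morphism eliminate.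
Proof.
move=> x y; rewrite /eliminate raddfB scalerBl !opprD !opprK.
exact: addrACA.
Qed.
HB.instance Definition _ :=
  GRing.isZmodMorphism.Build _ _ eliminate eliminate_is_zmod_morphism.

Lemma eliminateK x : eliminate x + pivot_coord x *: b = x.
Proof. by rewrite subrK. Qed.

Lemma eliminate_pivot : b 0 j != 0 -> eliminate b = 0.
Proof.
by move=> bj; rewrite /eliminate /pivot_coord divff // scale1r subrr.
Qed.

Lemma dim_span_eliminate (B : {fset 'rV[R]_d}) :
  (\dim <<B>> <= (\dim <<eliminate @` B>>%VS).+1)%N.
Proof.
have sub : (<<B>> <= <<eliminate @` B>> + <[b]>)%VS.
  apply/span_subvP=> x xB; rewrite -(eliminateK x).
  by rewrite memv_add ?memvZ ?memv_line // memv_span // in_imfset.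
apply: leq_trans (dimvS sub) _.
apply: leq_trans (dimv_add_leqif _ _) _.
by rewrite dim_vline -[leqRHS]addn1 leq_add2l leq_b1.
Qed.

(** A fibre of [eliminate] lies on a line parallel to [b], where [pivot_coord]
is injective, so the one-dimensional bound [k * (f - 1) + 1] applies; it is at
least [k * f / 2] because [f >= 2]. *)
Lemma card_nsum_fiber (B : {fset 'rV[R]_d}) y k :
  (1 < #|` [fset x in B | eliminate x == y]|)%N ->
  (k * #|` [fset x in B | eliminate x == y]|
     <= 2 * #|` nsum [fset x in B | eliminate x == y] k|)%N.
Proof.
set F := [fset x in B | _] => F1.
have inj : {in F &, injective pivot_coord}.
  move=> x z; rewrite !inE /= => /andP[_ /eqP ex] /andP[_ /eqP ez] pxz.
  by rewrite -(eliminateK x) -(eliminateK z) ex ez pxz.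
have cF : #|` pivot_coord @` F| = #|` F| by rewrite card_in_imfset.
have F0 : pivot_coord @` F != fset0 by rewrite -cardfs_gt0 cF ltnW.
have := card_nsum_real k F0; rewrite cF nsum_imfset => lt1.
have := leq_trans lt1 (leq_imfset_card _ _ _).
set a := #|` nsum F k|; nia.
Qed.

Lemma eliminate_nsum_fiber (B : {fset 'rV[R]_d}) y k z :
  z \in nsum [fset x in B | eliminate x == y] k -> eliminate z = y *+ k.
Proof.
elim: k z => [|k IH] z; first by rewrite inE => /eqP->; rewrite raddf0.
move=> /sumsetP[u [v [+ /IH ev ->]]]; rewrite !inE /= => /andP[_ /eqP eu].
by rewrite raddfD /= eu ev mulrS.
Qed.

End Elimination.

(** Induction on the dimension.  Project [B] along one of its nonzero elements
[b], and let [F] be the largest fibre; then [#|B|] is at most the product of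
the number of fibres and [#|F|].  The iterated sumset of the projection is
bounded below by induction, and above each of its points lies a translate of
the [k]-fold sumset of [F].  The extra summand (the successor) makes the
statement true for [r = 0] without bounding the dimension of [B] from
above. *)
Lemma card_nsum_ge (R : realFieldType) (d : nat) (B : {fset 'rV[R]_d}) r k :
  0 \in B -> (r <= \dim <<B>>)%N ->
  (k ^ r * #|` B| <= 2 ^ r * #|` nsum B (r * k).+1|)%N.
Proof.
elim: r B => [|r IH] B B0 rB; first by rewrite !mul1n nsum1.
have [b bB bn0] : exists2 b, b \in B & b != 0.
  apply/hasP; apply: contraT => /hasPn nob.
  suff B00 : (<<B>> <= 0)%VS by move: (dimvS B00); rewrite dimv0; lia.
  by apply/span_subvP=> x /nob; rewrite negbK memv0.
have [j bj] : exists j, b 0 j != 0 by apply/rV0Pn.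
pose g := eliminate b j.
have gb : g b = 0 by apply: eliminate_pivot.
have g0 : g 0 = 0 := raddf0 (eliminate b j).
have gD : {morph g : x y / x + y} := raddfD (eliminate b j).
have B'0 : 0 \in g @` B by apply/imfsetP; exists b.
have {rB IH} IH := IH _ B'0 (leq_trans rB (dim_span_eliminate b j B)).
have Bn0 : B != fset0 by apply/fset0Pn; exists b.
have [y0 cB y0max] := exists_large_fiber g Bn0.
set F := [fset x in B | g x == y0] in cB y0max.
(* The fibre over 0 contains both 0 and b, so the largest fibre has at least
   two points. *)
have F2 : (1 < #|` F|)%N.
  apply: leq_trans (y0max 0); apply: (@leq_trans #|` [fset 0; b]|).
    by rewrite cardfs2 eq_sym bn0.
  apply: fsubset_leq_card; apply/fsubsetP=> x; rewrite !inE /=.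
  by case/orP=> /eqP->; rewrite ?B0 ?bB /= ?gb ?g0.
have cF := card_nsum_fiber k F2.
pose Y := [fset y0 *+ k + y | y in nsum (g @` B) (r * k).+1].
have cY : #|` Y| = #|` nsum (g @` B) (r * k).+1|.
  exact: card_translate.
have cE : (#|` Y| * #|` nsum F k| <= #|` nsum B (r.+1 * k).+1|)%N.
  apply: (leq_card_fibers (f := g)) => _ /imfsetP[/= y + ->].
  rewrite nsum_imfset => /imfsetP[/= x xB ->].
  rewrite -(card_translate x); apply: fsubset_leq_card.
  apply/fsubsetP=> _ /imfsetP[/= z zF ->]; rewrite !inE /= gD.
  have gz : g z = _ := eliminate_nsum_fiber zF.
  rewrite gz (addrC (g x)) eqxx andbT.
  rewrite mulSn addnC -addSn; apply: nsumD => //.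
  apply: (fsubsetP (nsumS _ _)) zF.
  by apply/fsubsetP=> u; rewrite !inE => /andP[].
rewrite cY in cE.
rewrite !expnS -!mulnA.
apply: (@leq_trans (k * (k ^ r * (#|` g @` B| * #|` F|)))%N).
  by rewrite !leq_mul2l cB !orbT.
apply: (@leq_trans (2 * (2 ^ r * (#|` nsum (g @` B) (r * k).+1|
                                    * #|` nsum F k|)))%N);
  last by rewrite !leq_mul2l cE !orbT.
rewrite -/g in IH.
have := leq_mul IH cF.
rewrite -/F.
set A1 := #|` nsum F k|; set A2 := #|` nsum _ _|; set A3 := #|` F|.
set A4 := #|` _|.
move: (k ^ r)%N (2 ^ r)%N => K T.
by congr (_ <= _)%N; nia.
Qed.

(** * Points that a translation moves out of a finite set *)

Definition escape (G : zmodType) (S : {fset G}) (x : G) : nat :=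
  #|` [fset s in S | s + x \notin S]|.

Lemma escape0 (G : zmodType) (S : {fset G}) : escape S 0 = 0%N.
Proof.
apply/eqP; rewrite cardfs_eq0; apply/eqP/fsetP=> s; rewrite !inE /= addr0.
by rewrite andbN.
Qed.

(** If [s] leaves [S] under [x + y], then either [s] leaves under [x], or
[s + x] is still in [S] and leaves under [y]. *)
Lemma escapeD (G : zmodType) (S : {fset G}) x y :
  (escape S (x + y) <= escape S x + escape S y)%N.
Proof.
pose U := [fset s in S | (s + x \in S) && (s + x + y \notin S)].
have cU : (#|` U| <= escape S y)%N.
  rewrite -(card_translate x); apply: fsubset_leq_card.
  apply/fsubsetP=> _ /imfsetP[/= s + ->]; rewrite !inE /=.
  by rewrite (addrC x); case/and3P=> _ -> ->.
apply: (@leq_trans #|` [fset s in S | s + x \notin S] `|` U|).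
  apply: fsubset_leq_card; apply/fsubsetP=> s; rewrite !inE /= addrA.
  by case/andP=> -> ->; case: (_ \in _).
by apply: leq_trans (leq_card_fsetU _ _) _; rewrite leq_add2l.
Qed.

Lemma escape_nsum (G : zmodType) (S B : {fset G}) t k x :
  (forall b, b \in B -> escape S b <= t)%N -> x \in nsum B k ->
  (escape S x <= k * t)%N.
Proof.
move=> Bt; elim: k x => [|k IH] x.
  by rewrite inE => /eqP->; rewrite escape0.
move=> /sumsetP[u [v [/Bt ut /IH vt ->]]].
by apply: leq_trans (escapeD _ _ _) _; rewrite mulSn leq_add.
Qed.

(** A pair of points of [S] determines the translation between them, so the
numbers of points that stay in [S] add up over [X] to at most [#|S| ^ 2]. *)
Lemma exists_large_escape (G : zmodType) (S X : {fset G}) :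
  S != fset0 -> (2 * #|` S| <= #|` X|)%N ->
  exists2 x, x \in X & (#|` S| <= 2 * escape S x)%N.
Proof.
move=> S0 SX; apply/hasP; apply: contraT => /hasPn noX.
pose stay x := #|` [fset s in S | s + x \in S]|.
have stayE x : (escape S x + stay x = #|` S|)%N.
  rewrite /escape /stay -!sum_mem_count -big_split /= card_fset_sum1.
  by apply: eq_bigr => s _; case: (_ \in _).
have sum_stay : (\sum_(x <- X) stay x <= #|` S| * #|` S|)%N.
  under eq_bigr => x _ do rewrite /stay -sum_mem_count.
  rewrite exchange_big /= -sum_fset_const; apply: leq_sum => s _.
  rewrite sum_mem_count -(card_translate s).
  apply: fsubset_leq_card; apply/fsubsetP=> _ /imfsetP[/= x + ->].
  by rewrite !inE /= => /andP[].
have stay_lt x : x \in X -> (#|` S| < 2 * stay x)%N.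
  by move=> /noX; have := stayE x; set a := #|` S|; lia.
have : (#|` X| * #|` S|.+1 <= 2 * \sum_(x <- X) stay x)%N.
  rewrite big_distrr /= -sum_fset_const big_seq [leqRHS]big_seq.
  exact: leq_sum.
rewrite -cardfs_gt0 in S0.
set a := #|` S| in S0 SX sum_stay *; set c := #|` X| in SX *; nia.
Qed.

(** The iterated sumset of [B] and [0] has at least [2 * #|S|] points, so one of
them has escape at least [#|S| / 2]; by subadditivity one of its at most
[d * k + 1] summands in [B] has a proportional share of it. *)
Lemma exists_escape_spanning (R : realFieldType) (d : nat)
    (S B : {fset 'rV[R]_d}) k :
  S != fset0 -> <<B>>%VS = fullv ->
  (2 ^ d.+1 * #|` S| <= k ^ d * #|` B|)%N ->
  exists2 b, b \in B & (#|` S| <= 2 * (d * k).+1 * escape S b)%N.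
Proof.
move=> S0 spB SB; apply/hasP; apply: contraT => /hasPn noB.
pose B1 : {fset 'rV[R]_d} := 0 |` B.
have spB0 : (d <= \dim <<B1>>%VS)%N.
  have dB : \dim <<B>>%VS = d by rewrite spB dimvf /dim /= mul1n.
  rewrite -[leqLHS]dB.
  by apply/dimvS/sub_span => x xB; rewrite in_fset1U xB orbT.
have B00 : 0 \in B1 by rewrite in_fset1U eqxx.
have := card_nsum_ge k B00 spB0; set X := nsum _ _ => cX.
have SX : (2 * #|` S| <= #|` X|)%N.
  rewrite -(@leq_pmul2l (2 ^ d)) ?expn_gt0 //.
  rewrite mulnA -expnSr; apply: leq_trans SB _; apply: leq_trans cX.
  by rewrite leq_mul2l fsubset_leq_card ?orbT // fsubsetUr.
have [x xX Sx] := exists_large_escape S0 SX.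
have B1n : B1 != fset0 by apply/fset0Pn; exists 0.
have [b bB bmax] := fset_argmax (escape S) B1n.
have := leq_trans Sx (leq_mul (leqnn 2) (escape_nsum bmax xX)); rewrite mulnA.
move: bB; rewrite in_fset1U => /predU1P[->|/noB /negP//].
by rewrite escape0 muln0 leqn0 cardfs_eq0 (negPf S0).
Qed.

(** * Subset sums of one more element *)

Lemma FSP (G : zmodType) (A : {fset G}) z :
  reflect (exists2 B : {fset G}, B `<=` A & z = \sum_(x <- B) x) (z \in FS A).
Proof.
apply: (iffP (imfsetP _ _ _ _)) => /= -[B BA ->]; exists B => //.
  by rewrite -fpowersetE.
by rewrite fpowersetE.
Qed.

Lemma FSS (G : zmodType) (A C : {fset G}) : A `<=` C -> FS A `<=` FS C.
Proof.
move=> AC; apply/fsubsetP=> _ /FSP[B BA ->]; apply/FSP; exists B => //.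
exact: fsubset_trans AC.
Qed.

Lemma FS_neq0 (G : zmodType) (A : {fset G}) : FS A != fset0.
Proof.
apply/fset0Pn; exists 0; apply/FSP; exists fset0; first exact: fsub0set.
by rewrite big_seq_fset0.
Qed.

Lemma sub_FS (G : zmodType) (A : {fset G}) : A `<=` FS A.
Proof.
apply/fsubsetP=> x xA; apply/FSP; exists [fset x]; first by rewrite fsub1set.
by rewrite big_seq_fset1.
Qed.

Lemma card_FS_insert (G : zmodType) (A : {fset G}) b :
  b \notin A -> (#|` FS A| + escape (FS A) b <= #|` FS (b |` A)|)%N.
Proof.
move=> bA; pose S := FS A; pose E := [fset s in S | s + b \notin S].
pose bE := [fset b + s | s in E].
have <- : #|` bE| = escape S b by apply: card_translate.
have dis : S `&` bE = fset0.
  apply/fsetP=> z; rewrite !inE; apply/negP=> /andP[zS /imfsetP[/= s + zE]].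
  by rewrite !inE /= => /andP[_]; rewrite addrC -zE zS.
rewrite -cardfsUI dis cardfs0 addn0; apply: fsubset_leq_card.
rewrite fsubUset FSS ?fsubsetUr //=; apply/fsubsetP=> _ /imfsetP[/= s + ->].
rewrite !inE /= => /andP[/FSP[B BA ->] _]; apply/FSP; exists (b |` B).
  exact: fsetUS.
by rewrite big_fsetU1 //; apply: contra bA; apply/fsubsetP.
Qed.

(** * Growth of the subset sums *)

(** The passage from threshold [e0 = i ^ d] to [e1 = (i + 1) ^ d]: the gain
[1 + s / m] of the steps is at least the ratio [e1 / e0], which is at most
[1 + c / i]. *)
Lemma combine_growth i n N N0 m C c e0 e1 s :
  (0 < m -> 0 < i -> i * e1 <= e0 * (i + c) -> m * c <= i * s ->
   (m + s) * N0 <= m * N -> e0 * n <= C * N0 -> e1 * n <= C * N)%N.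
Proof.
move=> m0 i0 e01 mcs grow start.
rewrite -(@leq_pmul2l (m * i)) ?muln_gt0 ?m0 //.
apply: (@leq_trans (m * (i + c) * (e0 * n))).
  have -> : (m * i * (e1 * n) = m * n * (i * e1))%N by ring.
  have -> : (m * (i + c) * (e0 * n) = m * n * (e0 * (i + c)))%N by ring.
  by rewrite leq_mul2l e01 orbT.
apply: (@leq_trans (i * (m + s) * (C * N0))).
  apply: leq_mul start; rewrite mulnDr [leqRHS]mulnDr (mulnC m i).
  by rewrite leq_add2l.
have -> : (i * (m + s) * (C * N0) = i * C * ((m + s) * N0))%N by ring.
have -> : (m * i * (C * N) = i * C * (m * N))%N by ring.
by rewrite leq_mul2l grow orbT.
Qed.

Section Growth.
Variables (R : realFieldType) (d q : nat) (A : {fset 'rV[R]_d}).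
Hypothesis q_gt1 : (1 < q)%N.
Hypothesis spanA : forall A' : {fset 'rV[R]_d}, A' `<=` A ->
  (q * #|` A'| <= #|` A|)%N -> <<A `\` A'>>%VS = fullv.

(** At most half of [A] is used, since [1 < q], which accounts for one of the two
additional factors 2 in [2 ^ d.+2]; the other comes from
[exists_escape_spanning]. *)
Lemma FS_step (A' : {fset 'rV[R]_d}) k :
  A' `<=` A -> (q * #|` A'| <= #|` A|)%N ->
  (2 ^ d.+2 * #|` FS A'| <= k ^ d * #|` A|)%N ->
  exists A'' : {fset 'rV[R]_d}, [/\ A'' `<=` A, #|` A''| = (#|` A'|).+1
    & (#|` FS A'| <= 2 * (d * k).+1 * (#|` FS A''| - #|` FS A'|))%N].
Proof.
move=> A'A qA' kA.
have half : (#|` A| <= 2 * #|` A `\` A'|)%N.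
  rewrite cardfsDS //; have := fsubset_leq_card A'A.
  by set a := #|` A'| in qA' *; set n := #|` A| in qA' *; nia.
have [|b bA Ab] := exists_escape_spanning (k := k) (FS_neq0 A') (spanA A'A qA').
  rewrite -(@leq_pmul2l 2) // mulnA -expnS mulnCA.
  by apply: leq_trans kA _; rewrite leq_mul2l half orbT.
move: bA; rewrite in_fsetD => /andP[bA' bA].
exists (b |` A'); split.
- by rewrite fsubUset fsub1set bA.
- by rewrite cardfsU1 bA'.
- apply: leq_trans Ab _; rewrite leq_mul2l; apply/orP; right.
  by rewrite leq_subRL ?card_FS_insert // fsubset_leq_card // FSS // fsubsetUr.
Qed.

(** Within a stage [k] is fixed, so the gains of the [s] steps are all measured
against the initial number of subset sums and simply add up; the stage may stop
early once [FS A'] is too large for [FS_step]. *)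
Lemma FS_stage (A0 : {fset 'rV[R]_d}) k s :
  A0 `<=` A -> (q * (#|` A0| + s) <= #|` A|)%N ->
  exists A' : {fset 'rV[R]_d}, [/\ A' `<=` A, (#|` A'| <= #|` A0| + s)%N
    & (k ^ d * #|` A| <= 2 ^ d.+2 * #|` FS A'|)%N \/
      ((2 * (d * k).+1 + s) * #|` FS A0| <= 2 * (d * k).+1 * #|` FS A'|)%N].
Proof.
move=> A0A; elim: s => [|s IH] qs.
  by exists A0; split; rewrite ?addn0 //; right.
have [|A' [A'A cA' A'FS]] := IH.
  by apply: leq_trans qs; rewrite leq_mul2l leq_add2l leqnSn orbT.
case: A'FS => [A'FS|A'FS].
  by exists A'; split => //; [rewrite addnS ltnW | left].
have [kA|kA] := leqP (k ^ d * #|` A|) (2 ^ d.+2 * #|` FS A'|).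
  by exists A'; split => //; [rewrite addnS ltnW | left].
have qA' : (q * #|` A'| <= #|` A|)%N.
  apply: leq_trans qs; rewrite leq_mul2l; apply/orP; right.
  by apply: leq_trans cA' _; rewrite leq_add2l.
have [A'' [A''A cA'' A''FS]] := FS_step A'A qA' (ltnW kA).
exists A''; split=> //; first by rewrite cA'' addnS ltnS.
right; have : (0 < #|` FS A'|)%N by rewrite cardfs_gt0 FS_neq0.
move: A'FS A''FS; set m := (2 * _)%N; clearbody m.
set N := #|` FS A''|; set N0 := #|` FS A0|; set N' := #|` FS A'|.
nia.
Qed.

Lemma expn_succ_le i e : (0 < i)%N -> (i * i.+1 ^ e <= i ^ e * (i + 2 ^ e))%N.
Proof.
move=> i0; (* The induction closes only with 2 ^ e - 1, since 2 * (2 ^ e - 1) + 1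
   = 2 ^ (e + 1) - 1. *)
suff : (i * i.+1 ^ e <= i ^ e * (i + (2 ^ e).-1))%N.
  by move/leq_trans; apply; rewrite leq_mul2l leq_add2l leq_pred orbT.
elim: e => [|e IH]; first by rewrite !expn0; lia.
rewrite !expnS; have := expn_gt0 2 e; move: IH.
by move: (i.+1 ^ e)%N (i ^ e)%N (2 ^ e)%N => a b c IH /= c0; nia.
Qed.

(** Each of the [u] thresholds costs a stage of [s] steps, where [s] is chosen
so that [2 * (d * (i + 1) + 1) * 2 ^ d <= i * s] for all [i >= 1].  Half of the
elements that may be used, [s * u] of them, form the initial set; the factor
[q] in the constant makes that set large enough for the first threshold. *)
Lemma FS_grow (u : nat) (s := ((4 * d).+2 * 2 ^ d)%N) :
  (0 < u)%N -> (2 * q * s * u <= #|` A|)%N -> (#|` A| <= 4 * q * s * u)%N ->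
  (u ^ d * #|` A| <= 2 ^ d.+2 * q * #|` FS A|)%N.
Proof.
move=> u0 uA Au.
have q0 : (0 < q)%N by lia.
have s0 : (0 < s)%N by rewrite muln_gt0 expn_gt0.
suff main i : (0 < i)%N -> (i <= u)%N -> exists A' : {fset 'rV[R]_d},
    [/\ A' `<=` A, (#|` A'| <= s * u + s * i)%N
      & (i ^ d * #|` A| <= 2 ^ d.+2 * q * #|` FS A'|)%N].
  have [A' [A'A _ A'FS]] := main u u0 (leqnn u).
  apply: leq_trans A'FS _; rewrite leq_mul2l.
  by rewrite fsubset_leq_card ?orbT // FSS.
elim: i => // -[_ _ _|i IH _ iu].
  have suA : (s * u <= size A)%N.
    by rewrite (leq_trans _ uA) // -mulnA leq_pmull // muln_gt0.
  pose A0 : {fset 'rV[R]_d} := [fset x in take (s * u) A].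
  have cA0 : #|` A0| = (s * u)%N.
    by rewrite card_fseq undup_id ?take_uniq ?fset_uniq // size_takel.
  have A0A : A0 `<=` A by apply/fsubsetP => x; rewrite inE => /mem_take.
  exists A0; split=> //; first by rewrite cA0 leq_addr.
  rewrite exp1n mul1n; apply: leq_trans Au _.
  have := fsubset_leq_card (sub_FS A0); rewrite cA0.
  have := expn_gt0 2 d; rewrite !expnS /=.
  move: (2 ^ d)%N (#|` FS A0|) => c N c0 suN.
  apply: (@leq_trans (4 * q * N)); first by rewrite -mulnA leq_mul2l suN orbT.
  by rewrite !leq_mul2r (_ : 4 <= 2 * (2 * c))%N ?orbT //; lia.
have [A0 [A0A cA0 A0FS]] := IH isT (ltnW iu).
have qs : (q * (#|` A0| + s) <= #|` A|)%N.
  have E : (2 * q * s * u = q * (s * u + s * u))%N by lia.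
  rewrite E in uA.
  apply: leq_trans uA; rewrite leq_mul2l; apply/orP; right.
  apply: (@leq_trans (s * u + s * i.+2)); last first.
    by rewrite leq_add2l leq_mul2l iu orbT.
  by rewrite [(s * i.+2)%N]mulnS (addnC s) addnA leq_add2r.
have [A' [A'A cA' A'FS]] := FS_stage i.+2 A0A qs.
exists A'; split=> //.
  by apply: leq_trans cA' _; rewrite [(s * i.+2)%N]mulnS (addnC s) addnA leq_add2r.
case: A'FS => A'FS.
  by apply: leq_trans A'FS _; rewrite -mulnA leq_mul2l leq_pmull ?orbT.
have := @expn_succ_le i.+1 d isT.
have ms : (2 * (d * i.+2).+1 * 2 ^ d <= i.+1 * s)%N.
  by rewrite /s mulnA leq_mul2r; apply/orP; right; nia.
move: ms A'FS A0FS; set m := (2 * (d * i.+2).+1)%N.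
move=> ms A'FS A0FS es.
exact: combine_growth es ms A'FS A0FS.
Qed.

End Growth.

(** [FS_grow] with [u] the largest admissible number of stages, which is of order
[#|A|]; if there is no room for even one stage, [#|A|] is bounded and a single
subset sum is enough. *)
Lemma card_FS_ge (R : realFieldType) (d q : nat) (A : {fset 'rV[R]_d})
    (s := ((4 * d).+2 * 2 ^ d)%N) :
  (1 < q)%N ->
  (forall A' : {fset 'rV[R]_d}, A' `<=` A ->
     (q * #|` A'| <= #|` A|)%N -> <<A `\` A'>>%VS = fullv) ->
  (#|` A| ^ d.+1
     <= (4 * q * s) ^ d.+1 * (2 ^ d.+2 * q) * #|` FS A|)%N.
Proof.
move=> q1 spA.
have s0 : (0 < s)%N by rewrite muln_gt0 expn_gt0.
have c0 : (0 < 2 ^ d.+2 * q)%N by rewrite muln_gt0 expn_gt0 /= ltnW.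
have qs0 : (0 < q * s)%N by rewrite muln_gt0 s0 ltnW.
have [small|large] := ltnP #|` A| (2 * q * s).
  rewrite -mulnA; apply: (@leq_trans ((4 * q * s) ^ d.+1)).
    by rewrite leq_exp2r // (leq_trans (ltnW small)) // -!mulnA leq_mul2r orbT.
  by rewrite leq_pmulr // muln_gt0 c0 cardfs_gt0 FS_neq0.
pose u := (#|` A| %/ (2 * q * s))%N.
have uqs0 : (0 < 2 * q * s)%N by rewrite -mulnA muln_gt0.
have u0 : (0 < u)%N by rewrite divn_gt0.
have uA : (2 * q * s * u <= #|` A|)%N by rewrite mulnC leq_divM.
have Au : (#|` A| <= 4 * q * s * u)%N.
  apply: ltnW; apply: leq_trans (ltn_ceil _ uqs0) _; rewrite -/u.
  rewrite (_ : 4 * q * s * u = (u + u) * (2 * q * s))%N; last by ring.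
  by rewrite leq_mul2r -[u in (u < _)%N]addn0 ltn_add2l u0 orbT.
have := FS_grow q1 spA u0 uA Au; rewrite -/s => growth.
rewrite expnSr; apply: (@leq_trans ((4 * q * s) ^ d * (u ^ d * #|` A|))).
  have leq_expn a b e : (a <= b -> a ^ e <= b ^ e)%N.
    by case: e => // e ab; rewrite leq_exp2r.
  by rewrite mulnA -expnMn leq_mul2r leq_expn ?orbT.
apply: leq_trans (leq_mul (leqnn _) growth) _.
by rewrite mulnA !leq_mul2r leq_pexp2l ?orbT // -mulnA muln_gt0.
Qed.

Theorem theorem1p3 (R : realType) (d : nat) (hd : (0 < d)%N)
    (eps : R) (heps0 : 0 < eps) (heps1 : eps < 1) :
  exists gamma : R, 0 < gamma /\
    forall (n : nat) (A : {fset 'rV[R]_d}),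
      (0 < n)%N -> #|` A| = n ->
      (forall V : {vspace 'rV[R]_d}, V <> fullv ->
         #|` [fset x in A | x \in V]|%:R <= (1 - eps) * n%:R) ->
      gamma * n%:R ^+ d.+1 <= #|` FS A|%:R.
Proof.
(* Removing a proportion 1 / q < eps of A leaves more than (1 - eps) n elements,
   too many for a proper subspace. *)
pose q := (Num.truncn eps^-1).+2.
have q1 : (1 < q)%N by [].
have qeps : 1 < q%:R * eps.
  rewrite -ltr_pdivrMr // mul1r; apply: lt_trans (truncnS_gt _) _.
  by rewrite ltr_nat.
pose s := ((4 * d).+2 * 2 ^ d)%N.
pose K := ((4 * q * s) ^ d.+1 * (2 ^ d.+2 * q))%N.
have K0 : 0 < K%:R :> R.
  by rewrite ltr0n !(muln_gt0, expn_gt0).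
exists K%:R^-1; split; first by rewrite invr_gt0.
move=> n A n0 cA hA; rewrite ler_pdivrMl // -natrX -natrM ler_nat -cA.
apply: card_FS_ge => // A' A'A; rewrite cA => qA'.
apply/eqP; apply: contraT => /eqP /hA.
have : (#|` A `\` A'| <= #|` [fset x in A | x \in <<A `\` A'>>%VS]|)%N.
  apply: fsubset_leq_card; apply/fsubsetP=> x xAA'; rewrite !inE /=.
  by rewrite memv_span // andbT; move: xAA'; rewrite inE => /andP[].
rewrite cardfsDS // cA leq_subLR -(ler_nat R) natrD.
have n0R : 0 < n%:R :> R by rewrite ltr0n.
move: qA'; rewrite -(ler_nat R) natrM.
set a : R := #|` A'|%:R; set b : R := _%:R; move=> qa nab bn.
have epsa : eps * n%:R <= a by lra.
have : q%:R * (eps * n%:R) <= n%:R.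
  by apply: le_trans qa; rewrite ler_pM2l // ltr0n.
by rewrite mulrA ger_pMl // leNgt qeps.
Qed.
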